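(* Let $X\in L^\infty$, $n\ge1$, $\alpha_1,\dots,\alpha_n\in[0,1/2)$ and $\alpha=\sum_{i=1}^n\alpha_i$. Consider $n$ agents, agent $i$ having preference $\mathrm{IQD}_{\alpha_i}$, and allocations in $\mathbb A_n(X)$. (i) An allocation of $X$ is Pareto optimal in $\mathbb A_n(X)$ if and only if it is sum optimal in $\mathbb A_n(X)$. (ii) For $\lambda_1,\dots,\lambda_n\ge 0$ and $\lambda=\min_{i\in[n]}\lambda_i$, $$\mathop{\square}_{i=1}^n(\lambda_i\,\mathrm{IQD}_{\alpha_i})=\lambda\,\mathrm{IQD}_{\alpha}\quad\text{on }L^\infty .$$ In particular, $\mathop{\square}_{i=1}^n\mathrm{IQD}_{\alpha_i}=\mathrm{IQD}_\alpha$. (iii) A class of Pareto-optimal allocations of $X$ in $\mathbb A_n(X)$ is given by $$X_i=(X-c)\mathbf 1_{A_i\cup B_i}+a_i(X-c)(1-\mathbf 1_{A\cup B})+c_i,\qquad i\in[n],$$ where, setting $\beta=\min\{\alpha,1/2\}$, (a) $\{A_i\}_{i=1}^n$ and $\{B_i\}_{i=1}^n$ are partitions of, respectively, a right $\beta$-tail event $A$ and a left $\beta$-tail event $B$ of $X$, with $A,B$ disjoint, satisfying $\mathbb P(A_i)=\mathbb P(B_i)=\alpha_i\beta/\alpha$ for $i\in[n]$; (b) $a_i\ge0$ for $i\in[n]$ and $\sum_{i=1}^na_i=1$; (c) $c\in[Q^-_{1/2}(X),Q^+_{1/2}(X)]$, and $c_1,\dots,c_n\in\mathbb R$ with $\sum_{i=1}^nc_i=c$.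 That is, every $(X_1,\dots,X_n)$ of this form is a Pareto-optimal allocation.
   Context: $(\Omega,\mathcal F,\mathbb P)$ is an atomless probability space; a.s. equal random variables are identified; $L^\infty$ is the set of essentially bounded random variables; $[n]=\{1,\dots,n\}$. Quantiles are counted from large to small: for $t\in[0,1]$, $Q_t^-(X)=\inf\{x\in\mathbb R:\mathbb P(X\le x)\ge1-t\}$ and $Q_t^+(X)=\inf\{x\in\mathbb R:\mathbb P(X\le x)>1-t\}$ ($\inf\varnothing=\infty$). In particular $Q_0^-$ is the essential supremum and $Q_1^+$ the essential infimum. For $\alpha\in[0,1/2)$, $\mathrm{IQD}_\alpha(X)=Q_\alpha^-(X)-Q_{1-\alpha}^+(X)$; for $\alpha\ge1/2$, $\mathrm{IQD}_\alpha=0$. Allocations: $\mathbb A_n(X)=\{(X_1,\dots,X_n)\in(L^\infty)^n:\sum_{i=1}^nX_i=X\}$. For functionals $\rho_1,\dots,\rho_n:L^\infty\to\mathbb R$, $\mathop{\square}_{i=1}^n\rho_i(X)=\inf\{\sum_{i=1}^n\rho_i(X_i):(X_1,\dots,X_n)\in\mathbb A_n(X)\}$. For preferences $\rho_1,\dots,\rho_n$ (smaller is better), $(X_1,\dots,X_n)\in\mathbb A_n(X)$ is sum optimal if $\sum_i\rho_i(X_i)=\mathop{\square}_{i=1}^n\rho_i(X)$; it is Pareto optimal in $\mathbb A_n(X)$ if for any $(Y_1,\dots,Y_n)\in\mathbb A_n(X)$ with $\rho_i(Y_i)\le\rho_i(X_i)$ for all $i$, one has $\rho_i(Y_i)=\rho_i(X_i)$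 for all $i$. An event $A\in\mathcal F$ is a right (resp. left) $\beta$-tail event of $X$ if $\mathbb P(A)=\beta$ and $X(\omega)\ge X(\omega')$ (resp. $X(\omega)\le X(\omega')$) for a.s. all $\omega\in A$ and $\omega'\in A^c$. Members of a partition may be empty. If $\alpha=0$, then $\alpha_i\beta/\alpha$ is read as $0$. *)

(* Defs.v *)
From HB Require Import structures.
From mathcomp Require Import all_boot all_order all_algebra.
From mathcomp Require Import all_classical all_reals all_analysis.

Set Implicit Arguments.
Unset Strict Implicit.
Unset Printing Implicit Defensive.

Import Order.TTheory GRing.Theory Num.Theory.
Local Open Scope classical_set_scope.
Local Open Scope ring_scope.

Definition atomless d (T : measurableType d) (R : realType)
    (P : probability T R) : Prop :=
  forall A : set T, measurable A -> (0 < P A)%E ->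
    exists B : set T,
      [/\ measurable B, B `<=` A, (0 < P B)%E & (P B < P A)%E].

(* Elements are measurable, essentially bounded representatives. The
   identification of a.s. equal random variables is made wherever random
   variables are compared, through [\forall w \ae P, _]. *)
Definition Linfty d (T : measurableType d) (R : realType)
    (P : probability T R) : Type := LfunType P (leey 1%E).

(* Quantiles are counted from large to small: level [t] corresponds to the
   usual quantile at level [1 - t]. They take values in [\bar R], and
   [ereal_inf set0 = +oo]. *)
Definition Qminus d (T : measurableType d) (R : realType)
    (P : probability T R) (t : R) (X : {RV P >-> R}) : \bar R :=
  ereal_inf [set x%:E | x in [set x : R | ((1 - t)%:E <= cdf X x)%E]].

Definition Qplus d (T : measurableType d) (R : realType)
    (P : probability T R) (t : R) (X : {RV P >-> R}) : \bar R :=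
  ereal_inf [set x%:E | x in [set x : R | ((1 - t)%:E < cdf X x)%E]].

Arguments Qminus {d T R} P t X.
Arguments Qplus {d T R} P t X.

(* For [0 <= alpha < 1/2] both quantiles of an essentially bounded random
   variable are finite, so [fine] loses nothing. *)
Definition IQD d (T : measurableType d) (R : realType)
    (P : probability T R) (alpha : R) (X : Linfty P) : R :=
  if alpha < 2^-1 then fine (Qminus P alpha X - Qplus P (1 - alpha) X)%E else 0.

Definition allocation d (T : measurableType d) (R : realType)
    (P : probability T R) (n : nat) (X : Linfty P) : set ('I_n -> Linfty P) :=
  [set Y | \forall w \ae P, \sum_(i < n) Y i w = X w].

(* Valued in [\bar R], since the infimum may be [-oo] for general [rho]. *)
Definition infconv d (T : measurableType d) (R : realType)
    (P : probability T R) (n : nat) (rho : 'I_n -> Linfty P -> R)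
    (X : Linfty P) : \bar R :=
  ereal_inf [set (\sum_(i < n) rho i (Y i))%:E | Y in @allocation _ _ _ P n X].

Definition sum_optimal d (T : measurableType d) (R : realType)
    (P : probability T R) (n : nat) (rho : 'I_n -> Linfty P -> R)
    (X : Linfty P) (Y : 'I_n -> Linfty P) : Prop :=
  allocation X Y /\ (\sum_(i < n) rho i (Y i))%:E = infconv rho X.

Definition pareto_optimal d (T : measurableType d) (R : realType)
    (P : probability T R) (n : nat) (rho : 'I_n -> Linfty P -> R)
    (X : Linfty P) (Y : 'I_n -> Linfty P) : Prop :=
  allocation X Y /\
  forall Z : 'I_n -> Linfty P, allocation X Z ->
    (forall i, rho i (Z i) <= rho i (Y i)) ->
    forall i, rho i (Z i) = rho i (Y i).

Definition right_tail_event d (T : measurableType d) (R : realType)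
    (P : probability T R) (beta : R) (X : Linfty P) (A : set T) : Prop :=
  [/\ measurable A, P A = beta%:E &
      \forall w \ae P, \forall w' \ae P, A w -> (~` A) w' -> X w' <= X w].

Definition left_tail_event d (T : measurableType d) (R : realType)
    (P : probability T R) (beta : R) (X : Linfty P) (A : set T) : Prop :=
  [/\ measurable A, P A = beta%:E &
      \forall w \ae P, \forall w' \ae P, A w -> (~` A) w' -> X w <= X w'].

(* The library's [partition] requires nonempty members; here members may be
   empty. *)
Definition event_partition d (T : measurableType d) (n : nat)
    (A : set T) (A_ : 'I_n -> set T) : Prop :=
  [/\ forall i, measurable (A_ i), trivIset setT A_ & \bigcup_i A_ i = A].

(* Main.v *)
(**
For every [alpha >= 0], [IQD alpha X] is the minimum of [hi - lo] over
[lo <= hi] such that [X > hi] and [X < lo] each have probability at most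
[alpha]. A union bound then shows that the sum of [IQD (alpha_ i) (Y i)] over
an allocation [Y] of [X] is at least [IQD alpha X]. Conversely, for an optimal
pair [lo <= hi], atomlessness splits the events [X > hi] and [X < lo] among the
agents so that agent [i] gets pieces of probability at most [alpha_ i]; the
pieces cost an agent nothing, and the rest of [X], of range at most [hi - lo],
can be shared in any proportions [v i], at cost at most [v i * (hi - lo)]. The
weighted inf-convolution is attained by giving the rest to an agent with minimal
[lambda_ i]. A Pareto-optimal allocation must be sum optimal, since otherwise
sharing in proportion to its own costs would improve it.
*)
Require Import Defs.
From HB Require Import structures.
From mathcomp Require Import all_boot all_order all_algebra.
From mathcomp Require Import all_classical all_reals all_analysis.
From mathcomp Require Import ess_sup_inf measurable_realfun ring lra.

Set Implicit Arguments.
Unset Strict Implicit.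
Unset Printing Implicit Defensive.

Import Order.TTheory GRing.Theory Num.Theory.
Local Open Scope classical_set_scope.
Local Open Scope ring_scope.

(** * Real-valued probabilities and almost sure comparisons *)

Section probability_value.
Context d (T : measurableType d) (R : realType) (P : probability T R).

Definition pr (A : set T) : R := fine (P A).

Lemma prE A : measurable A -> P A = (pr A)%:E.
Proof. by move=> mA; rewrite fineK// fin_num_measure. Qed.

Lemma pr_ge0 A : 0 <= pr A.
Proof. by rewrite fine_ge0. Qed.

Lemma pr_le1 A : measurable A -> pr A <= 1.
Proof. by move=> mA; rewrite -lee_fin -prE// probability_le1. Qed.

Lemma pr_set0 : pr set0 = 0.
Proof. by rewrite /pr measure0. Qed.

Lemma prC A : measurable A -> pr (~` A) = 1 - pr A.
Proof.
move=> mA; apply: EFin_inj.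
by rewrite -prE ?probability_setC ?prE//; exact: measurableC.
Qed.

Lemma prU A B : measurable A -> measurable B -> A `&` B = set0 ->
  pr (A `|` B) = pr A + pr B.
Proof.
move=> mA mB AB; apply: EFin_inj; rewrite EFinD -!prE//; last exact: measurableU.
exact: measureU.
Qed.

Lemma prU_le A B : measurable A -> measurable B -> pr (A `|` B) <= pr A + pr B.
Proof.
move=> mA mB; rewrite -lee_fin EFinD -!prE//; last exact: measurableU.
exact: measureU2.
Qed.

Lemma le_pr A B : measurable A -> measurable B -> A `<=` B -> pr A <= pr B.
Proof. by move=> mA mB AB; rewrite -lee_fin -!prE// le_measure ?inE. Qed.

Lemma prD A B : measurable A -> measurable B -> B `<=` A ->
  pr (A `\` B) = pr A - pr B.
Proof.
move=> mA mB BA; have mD := measurableD mA mB.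
have /(congr1 pr) : (A `\` B) `|` B = A by rewrite setUC setDUK.
by rewrite prU ?setDKI// => <-; rewrite addrK.
Qed.

Lemma ae_pr0 (Q : T -> Prop) : measurable [set w | ~ Q w] ->
  pr [set w | ~ Q w] = 0 -> \forall w \ae P, Q w.
Proof. by move=> mQ Q0; exists [set w | ~ Q w]; split=> //; rewrite prE// Q0. Qed.

(** The exceptional points lie in a null event [N], so [A] is contained in the union of [B] and
    [N]. *)
Lemma le_pr_ae A B : measurable A -> measurable B ->
  (\forall w \ae P, A w -> B w) -> pr A <= pr B.
Proof.
move=> mA mB [N [mN N0 AN]].
have prN : pr N = 0 by rewrite /pr N0.
rewrite -[pr B]addr0 -prN.
apply: le_trans (prU_le mB mN); apply: le_pr => // [|w Aw].
  exact: measurableU.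
have [Bw|nBw] := pselect (B w); first by left.
by right; apply: AN => /= /(_ Aw).
Qed.

Lemma pr_ae0 A : measurable A -> (\forall w \ae P, ~ A w) -> pr A = 0.
Proof.
move=> mA nA; apply/eqP; rewrite eq_le pr_ge0 andbT -pr_set0.
by apply: le_pr_ae => //; exact: filterS nA.
Qed.

Lemma pr_ae1 A : measurable A -> (\forall w \ae P, A w) -> pr A = 1.
Proof.
move=> mA PA; apply/eqP; rewrite -subr_eq0 -opprB oppr_eq0 -prC//; apply/eqP.
by apply: pr_ae0; [exact: measurableC|apply: filterS PA => w ? /(_ _)].
Qed.

Lemma pr_gt0_ex A (Q : T -> Prop) : measurable A -> 0 < pr A ->
  (\forall w \ae P, Q w) -> exists2 w, A w & Q w.
Proof.
move=> mA A0 PQ; apply: contrapT => nex; move: A0; rewrite pr_ae0 ?ltxx//.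
by apply: filterS PQ => w Qw Aw; apply: nex; exists w.
Qed.

(** Continuity from below: the probability of the union is the limit of the probabilities of the
    [F k]. *)
Lemma pr_bigcup_le (F : (set T)^nat) (t : R) : (forall k, measurable (F k)) ->
  nondecreasing_seq F -> (forall k, pr (F k) <= t) -> pr (\bigcup_k F k) <= t.
Proof.
move=> mF ndF Ft; have mU : measurable (\bigcup_k F k) by exact: bigcup_measurable.
rewrite -lee_fin -prE//; have cF := nondecreasing_cvg_mu (mu := P) mF mU ndF.
rewrite -(cvg_lim _ cF)//; apply: lime_le; first by apply/cvg_ex; eexists; exact: cF.
by apply: nearW => k /=; rewrite prE// lee_fin.
Qed.

Lemma pr_bigcup_ord_le n (F : 'I_n -> set T) : (forall i, measurable (F i)) ->
  pr (\bigcup_i F i) <= \sum_(i < n) pr (F i).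
Proof.
move=> mF; have -> : \bigcup_i F i = \big[setU/set0]_(i < n) F i.
  apply/seteqP; split=> [w [i _ Fiw]|]; first by rewrite (bigD1 i)//=; left.
  elim/big_ind: _ => [//|A B AU BU w [/AU|/BU]//|i _ w Fiw].
  by exists i.
suff [] : measurable (\big[setU/set0]_(i < n) F i) /\
  pr (\big[setU/set0]_(i < n) F i) <= \sum_(i < n) pr (F i) by [].
elim/big_rec2: _ => [|i s A _ [mA As]]; first by rewrite pr_set0.
split; first exact: measurableU.
by apply: le_trans (prU_le _ _) _ => //; rewrite lerD2l.
Qed.

End probability_value.

(** * Splitting events of an atomless space *)

Section atomless_splitting.
Context d (T : measurableType d) (R : realType) (P : probability T R).
Hypothesis P_atomless : atomless P.
Local Notation pr := (pr P).

(** Atomlessness cuts any event of positive probability into two such events; keeping the smaller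
    one at least halves the probability, and [k] rounds bring it down to [2 ^- k]. *)
Lemma atomless_small A (e : R) : measurable A -> 0 < pr A -> 0 < e ->
  exists B, [/\ measurable B, B `<=` A, 0 < pr B & pr B < e].
Proof.
move=> mA A0 e0.
have halve k : exists B, [/\ measurable B, B `<=` A, 0 < pr B & pr B * 2 ^+ k <= 1].
  elim: k => [|k [B [mB BA B0 Bk]]].
    by exists A; split=> //; rewrite mulr1 pr_le1.
  have [|C [mC CB]] := P_atomless mB; first by rewrite prE// lte_fin.
  rewrite !prE// !lte_fin => C0 CltB.
  have mD := measurableD mB mC; have DE := prD P mB mC CB.
  have [Cle|Cgt] := leP (pr C * 2) (pr B).
    exists C; split=> //; first exact: subset_trans CB BA.
    by rewrite exprS mulrA (le_trans _ Bk)// ler_wpM2r// exprn_ge0.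
  exists (B `\` C); split=> //; first by move=> w [/BA].
    by rewrite DE subr_gt0.
  rewrite exprS mulrA (le_trans _ Bk)// ler_wpM2r ?exprn_ge0// DE; lra.
have [k ek] : exists k, e^-1 < 2 ^+ k.
  exists (Num.bound e^-1); apply: lt_le_trans (archi_boundP _) _.
    by rewrite invr_ge0 ltW.
  by rewrite -natrX ler_nat ltnW// ltn_expl.
have [B [mB BA B0 Bk]] := halve k; exists B; split=> //.
have k0 : 0 < 2 ^+ k :> R by rewrite exprn_gt0.
rewrite -(ltr_pM2r k0) (le_lt_trans Bk)//.
by rewrite -ltr_pdivrMl// mulr1.
Qed.

(* Iterating such near-optimal steps yields a set of maximal probability: the
   gains are summable, hence so are the largest possible gains. *)
Lemma greedy_step E (t : R) F : measurable F -> F `<=` E -> pr F <= t ->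
  exists G, [/\ measurable G, F `<=` G, G `<=` E, pr G <= t &
    forall H, measurable H -> F `<=` H -> H `<=` E -> pr H <= t ->
      pr H - pr F <= 2 * (pr G - pr F)].
Proof.
move=> mF FE Ft.
pose S := [set x | exists H, [/\ measurable H, F `<=` H, H `<=` E, pr H <= t & x = pr H]].
have S0 : S !=set0 by exists (pr F); exists F; split.
have Sb : has_ubound S by exists t => _ [H [_ _ _ Ht ->]].
have Fsup : pr F <= sup S by apply: ub_le_sup => //; exists F; split.
have [supF|Fltsup] := leP (sup S) (pr F).
  exists F; split=> // H mH FH HE Ht; rewrite subrr mulr0 subr_le0.
  by apply: le_trans supF; apply: ub_le_sup => //; exists H; split.
have [||_ [G [mG FG GE Gt ->]] Gsup] := @sup_adherent _ S ((sup S - pr F) / 2).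
- by rewrite divr_gt0 ?subr_gt0.
- by split.
exists G; split=> // H mH FH HE Ht.
have : pr H <= sup S by apply: ub_le_sup => //; exists H; split.
lra.
Qed.

(** The set is the union of a greedy chain started at the empty set. Maximality is claimed only
    among supersets of [F], which is what greedy steps control and what the construction of sets of
    prescribed probability uses. *)
Lemma exhaustion E (t : R) : measurable E -> 0 <= t ->
  exists F, [/\ measurable F, F `<=` E, pr F <= t &
    forall H, measurable H -> F `<=` H -> H `<=` E -> pr H <= t -> pr H <= pr F].
Proof.
move=> mE t0.
pose adm := {F | [/\ measurable F, F `<=` E & pr F <= t]}.
have adm0 : [/\ measurable (set0 : set T), set0 `<=` E & pr set0 <= t].
  by split=> //; rewrite pr_set0.
have step (F : adm) : {G : adm | sval F `<=` sval G /\
    forall H, measurable H -> sval F `<=` H -> H `<=` E -> pr H <= t ->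
      pr H - pr (sval F) <= 2 * (pr (sval G) - pr (sval F))}.
  case: F => F [mF FE Ft]; apply: cid => /=.
  have [G [mG FG GE Gt Gmax]] := greedy_step mF FE Ft.
  by exists (exist _ G (And3 mG GE Gt)).
pose F k : adm := iter k (fun G => sval (step G)) (exist _ set0 adm0).
pose f k := sval (F k).
have mf k : measurable (f k) by have [] := svalP (F k).
have fE k : f k `<=` E by have [] := svalP (F k).
have ft k : pr (f k) <= t by have [] := svalP (F k).
have fS k : f k `<=` f k.+1 by have [] := svalP (step (F k)).
have fmax k H : measurable H -> f k `<=` H -> H `<=` E -> pr H <= t ->
    pr H - pr (f k) <= 2 * (pr (f k.+1) - pr (f k)).
  by have [_] := svalP (step (F k)); exact.
have ndf : nondecreasing_seq f by apply/nondecreasing_seqP => k; exact/subsetPset.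
have mU : measurable (\bigcup_k f k) by exact: bigcup_measurable.
exists (\bigcup_k f k); split=> //; first exact: bigcup_sub.
  exact: pr_bigcup_le.
move=> H mH UH HE Ht.
(* A larger [H] extends every [f k], so each greedy step gains at least half of its excess over the
   union, that is [delta]; the probabilities would then exceed 1. *)
rewrite leNgt; apply/negP => UltH; pose delta := (pr H - pr (\bigcup_k f k)) / 2.
have delta0 : 0 < delta by rewrite divr_gt0 ?subr_gt0.
have grow k : delta *+ k <= pr (f k).
  elim: k => [|k IH]; first by rewrite mulr0n pr_ge0.
  have := fmax k H mH (subset_trans (@bigcup_sup _ _ k setT f I) UH) HE Ht.
  have : pr (f k) <= pr (\bigcup_k f k) by apply: le_pr => //; exact: bigcup_sup.
  by rewrite mulrSr; move: IH; rewrite /delta; lra.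
have := archi_boundP (ltW (divr_gt0 ltr01 delta0)); rewrite ltNge ler_pdivlMr// => /negP.
by apply; rewrite mulrC mulr_natr (le_trans (grow _))// pr_le1.
Qed.

(** A maximal subset of probability at most [t] reaches [t]: otherwise a small enough piece of the
    remainder could still be added. *)
Lemma sierpinski E (t : R) : measurable E -> 0 <= t <= pr E ->
  exists F, [/\ measurable F, F `<=` E & pr F = t].
Proof.
move=> mE /andP[t0 tE]; have [F [mF FE Ft Fmax]] := exhaustion mE t0.
exists F; split=> //; apply/eqP; rewrite eq_le Ft leNgt; apply/negP => Flt.
have mD := measurableD mE mF.
have [|||B [mB BD B0 Bt]] := @atomless_small (E `\` F) (t - pr F); rewrite ?subr_gt0//.
  by rewrite prD// subr_gt0 (lt_le_trans Flt).
have FB0 : F `&` B = set0 by apply/seteqP; split=> w // [Fw /BD[]].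
have UE : pr (F `|` B) = pr F + pr B by rewrite prU.
suff : pr (F `|` B) <= pr F by rewrite UE; lra.
apply: Fmax; [exact: measurableU|by left|by move=> w [/FE|/BD[]]|rewrite UE; lra].
Qed.

(** The pieces are cut off one at a time. At least one index is required because an empty family
    cannot cover a nonempty null event. *)
Lemma atomless_partition n (a : 'I_n.+1 -> R) E : measurable E ->
  (forall i, 0 <= a i) -> pr E <= \sum_(i < n.+1) a i ->
  exists2 E_ : 'I_n.+1 -> set T, event_partition E E_ & forall i, pr (E_ i) <= a i.
Proof.
elim: n a E => [|n IH] a E mE a0 Ea.
  exists (fun=> E) => [|i]; last by rewrite big_ord1 in Ea; rewrite ord1.
  split=> //; first by move=> i j _ _ _; rewrite !ord1.
  by apply/seteqP; split=> [w [_ _]|w Ew] //; exists ord0.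
(* The first piece is as large as its bound allows, so the remainder either fits the remaining
   bounds or is null. *)
have [|F [mF FE Ft]] := @sierpinski E (Num.min (a ord0) (pr E)) mE.
  by rewrite le_min a0 pr_ge0 ge_min lexx orbT.
have mD := measurableD mE mF.
have [||//|E_ [mE_ tE_ UE_] E_le] := IH (fun i => a (lift ord0 i)) (E `\` F) => //.
  rewrite prD// Ft; rewrite big_ord_recl in Ea.
  have : 0 <= \sum_(i < n.+1) a (lift ord0 i) by exact: sumr_ge0.
  by case: (leP (a ord0) (pr E)); lra.
have E_F i w : E_ i w -> ~ F w.
  move=> Eiw; suff [] : (E `\` F) w by [].
  by rewrite -UE_; exists i.
exists (fun i => if unlift ord0 i is Some j then E_ j else F) => [|i]; last first.
  by case: unliftP => [j|] ->//; rewrite Ft ge_min lexx.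
split.
- by move=> i; case: unliftP.
- move=> i j _ _; case: unliftP => [i' ->|->]; case: unliftP => [j' ->|->] //.
  + by move=> /(tE_ _ _ I I) ->.
  + by move=> [w [/E_F]].
  + by move=> [w [Fw /E_F]].
- apply/seteqP; split=> [w [i _]|w Ew].
    case: unliftP => [j _ Ejw|_ /FE//].
    suff [] : (E `\` F) w by [].
    by rewrite -UE_; exists j.
  have [Fw|nFw] := pselect (F w); first by exists ord0; rewrite // unlift_none.
  have : (E `\` F) w by [].
  by rewrite -UE_ => -[j _ Ejw]; exists (lift ord0 j) => //; rewrite liftK.
Qed.


End atomless_splitting.

(** * Quantiles and the variational form of [IQD] *)

Section quantiles.
Context d (T : measurableType d) (R : realType) (P : probability T R).
Local Notation pr := (pr P).
Implicit Types (f : T -> R) (X : Linfty P).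

Lemma measurable_gtr f c : measurable_fun setT f -> measurable [set w | c < f w].
Proof.
move=> mf; rewrite -[X in measurable X]setTI.
have -> : [set w | c < f w] = f @^-1` `]c, +oo[.
  by apply/seteqP; split=> w; rewrite /= in_itv/= andbT.
exact: mf.
Qed.

Lemma measurable_ltr f c : measurable_fun setT f -> measurable [set w | f w < c].
Proof.
move=> mf; rewrite -[X in measurable X]setTI.
have -> : [set w | f w < c] = f @^-1` `]-oo, c[.
  by apply/seteqP; split=> w; rewrite /= in_itv.
exact: mf.
Qed.

Lemma setC_gtr f c : ~` [set w | c < f w] = [set w | f w <= c].
Proof.
by apply/seteqP; split=> w /=; [move/negP; rewrite -leNgt|rewrite leNgt => /negP].
Qed.

Lemma measurable_ler f c : measurable_fun setT f -> measurable [set w | f w <= c].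
Proof. by move=> mf; rewrite -setC_gtr; apply/measurableC/measurable_gtr. Qed.

Lemma Linfty_measurable X : measurable_fun setT X.
Proof. exact: measurable_funP. Qed.
Hint Resolve Linfty_measurable : core.

Lemma Linfty_bounded X : exists M, \forall w \ae P, `|X w| <= M.
Proof.
have := Lfunction_finite (leey 1%E) X.
rewrite /finite_norm unlock /= probability_setT lte01.
exact: ess_supr_bounded.
Qed.

Lemma bounded_Linfty f M : measurable_fun setT f ->
  (\forall w \ae P, `|f w| <= M) -> f \in Lfun P +oo%E.
Proof.
move=> mf fM; apply/andP; split; rewrite inE//=.
rewrite /finite_norm unlock /= probability_setT lte01.
apply: (@le_lt_trans _ _ M%:E); last exact: ltry.
by apply/ess_supP; apply: filterS fM => w; rewrite lee_fin.
Qed.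

Lemma cdfE X x : cdf (P := P) X x = (1 - pr [set w | x < X w])%:E.
Proof.
rewrite -prC; last exact: measurable_gtr.
rewrite -prE; last by apply/measurableC/measurable_gtr.
by rewrite setC_gtr /cdf /distribution/= /pushforward; congr (P _).
Qed.

Lemma pr_gtr_le f c t : measurable_fun setT f ->
  (forall x, c < x -> pr [set w | x < f w] <= t) -> pr [set w | c < f w] <= t.
Proof.
move=> mf ft; have -> : [set w | c < f w] = \bigcup_k [set w | c + k.+1%:R^-1 < f w].
  apply/seteqP; split=> w /=.
    by move=> /ltr_add_invr[k ck]; exists k.
  by move=> [k _ /=]; apply: lt_trans; rewrite ltrDl invr_gt0.
apply: pr_bigcup_le => [k|k l kl|k]; first exact: measurable_gtr.
  apply/subsetPset => w /=; apply: le_lt_trans.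
  by rewrite lerD2l lef_pV2 ?posrE// ler_nat.
by apply: ft; rewrite ltrDl invr_gt0.
Qed.

(** Reflection of the previous lemma through [\- f]. The hypothesis speaks of [f w <= x] since this
    is the event the distribution function measures. *)
Lemma pr_ltr_le f c t : measurable_fun setT f ->
  (forall x, x < c -> pr [set w | f w <= x] <= t) -> pr [set w | f w < c] <= t.
Proof.
move=> mf ft.
have E x : [set w | (\- f) w > x] = [set w | f w < - x].
  by apply/seteqP; split=> w /=; rewrite ltrNr.
rewrite -[c]opprK -E; apply: pr_gtr_le; first exact: measurableT_comp.
move=> x cx; apply: le_trans (ft (- x) _); last by rewrite ltrNl.
apply: le_pr; [|exact: measurable_ler|by rewrite E => w /= /ltW].
by rewrite E; exact: measurable_ltr.
Qed.

(** Essential boundedness and [0 <= t < 1] make the defining set nonempty and bounded below; it is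
    upward closed and, by continuity from below, contains its infimum. Later arguments use only this
    equivalence. *)
Lemma QminusP X t : 0 <= t < 1 -> exists2 b, Qminus P t X = b%:E &
  forall x, (pr [set w | x < X w] <= t) = (b <= x).
Proof.
move=> /andP[t0 t1]; pose S := [set x | pr [set w | x < X w] <= t].
have [M XM] := Linfty_bounded X.
have SE : [set x : R | ((1 - t)%:E <= cdf (P := P) X x)%E] = S.
  by apply/seteqP; split=> x /=; rewrite cdfE lee_fin lerD2l lerN2.
have S0 : S !=set0.
  exists M; rewrite /S/= pr_ae0//; first exact: measurable_gtr.
  by apply: filterS XM => w /(le_trans (ler_norm _)); rewrite leNgt => /negP.
have Sb : has_lbound S.
  exists (- M) => x Sx; rewrite leNgt; apply/negP => xM; move: t1.
  rewrite ltNge => /negP; apply.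
  move: Sx; rewrite /S/= pr_ae1//; first exact: measurable_gtr.
  by apply: filterS XM => w; rewrite ler_norml => /andP[/(lt_le_trans xM)].
exists (inf S); first by rewrite /Qminus SE ereal_inf_EFin.
have Sup x y : x <= y -> S x -> S y.
  move=> xy; apply: le_trans; apply: le_pr; [exact: measurable_gtr..|move=> w /=].
  exact: le_lt_trans.
move=> x; apply/idP/idP => [Sx|]; first exact: ge_inf.
move=> /Sup; apply; apply: pr_gtr_le => // y /inf_lt [//|z Sz /ltW zy].
exact: Sup zy Sz.
Qed.

(** Level [1 - t] makes this quantile a bound on the lower tail. Every [y] below the infimum
    satisfies [pr [set w | X w <= y] <= t], and the bound passes to the limit from the left. *)
Lemma QplusP X t : 0 <= t < 1 -> exists2 a, Qplus P (1 - t) X = a%:E &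
  forall x, (pr [set w | X w < x] <= t) = (x <= a).
Proof.
move=> /andP[t0 t1]; pose S := [set x | t < pr [set w | X w <= x]].
have [M XM] := Linfty_bounded X.
have SE : [set x : R | ((1 - (1 - t))%:E < cdf (P := P) X x)%E] = S.
  apply/seteqP; split=> x /=; rewrite cdfE lte_fin subKr -prC ?setC_gtr//;
  exact: measurable_gtr.
have S0 : S !=set0.
  exists M; rewrite /S/= pr_ae1//; first exact: measurable_ler.
  by apply: filterS XM => w /(le_trans (ler_norm _)).
have Sb : has_lbound S.
  exists (- M) => x Sx; rewrite leNgt; apply/negP => xM; move: Sx.
  apply/negP; rewrite -leNgt pr_ae0//; first exact: measurable_ler.
  apply: filterS XM => w; rewrite ler_norml => /andP[/(lt_le_trans xM)].
  by rewrite ltNge => /negP.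
exists (inf S); first by rewrite /Qplus SE ereal_inf_EFin.
move=> x; apply/idP/idP => [Xx|xS].
  apply: lb_le_inf => // y Sy; rewrite leNgt; apply/negP => yx.
  move: Sy; apply/negP; rewrite -leNgt; apply: le_trans Xx; apply: le_pr.
  - exact: measurable_ler.
  - exact: measurable_ltr.
  - by move=> w /= /le_lt_trans; apply.
apply: pr_ltr_le => // y yx; rewrite leNgt; apply/negP => Sy.
by have := ge_inf Sb Sy; rewrite leNgt (lt_le_trans yx).
Qed.

Lemma pr_gtr_ltr_ge1 f x y : measurable_fun setT f -> x < y ->
  1 <= pr [set w | x < f w] + pr [set w | f w < y].
Proof.
move=> mf xy; apply: le_trans (prU_le _ _ _);
  [|exact: measurable_gtr|exact: measurable_ltr].
rewrite pr_ae1//.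
  by apply: measurableU; [exact: measurable_gtr|exact: measurable_ltr].
by apply: nearW => w /=; have [fx|] := leP (f w) x; [right; exact: le_lt_trans xy|left].
Qed.

(** Each side of the interval from [lo] to [hi] carries probability at most [alpha]. In particular,
    [central 2^-1 X c c] says that [c] is a median of [X]. *)
Definition central (alpha : R) f (lo hi : R) : Prop :=
  [/\ lo <= hi, pr [set w | hi < f w] <= alpha & pr [set w | f w < lo] <= alpha].

Lemma central_median X c :
  central 2^-1 X c c <-> (Qminus P 2^-1 X <= c%:E <= Qplus P 2^-1 X)%E.
Proof.
have h : 0 <= (2^-1 : R) < 1 by lra.
have [b -> bP] := QminusP X h; have [a] := QplusP X h.
have -> : 1 - 2^-1 = 2^-1 :> R by lra.
move=> -> aP; rewrite !lee_fin -bP -aP; split=> [[_ -> ->]//|/andP[? ?]].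
by split.
Qed.

(** The lower median [b] serves. If it exceeded the upper one [a], both tails at their midpoint
    would have probability above one half while being disjoint. *)
Lemma median_ex X : exists c, central 2^-1 X c c.
Proof.
have h : 0 <= (2^-1 : R) < 1 by lra.
have [b _ bP] := QminusP X h; have [a _ aP] := QplusP X h.
exists b; split; rewrite ?bP ?aP// leNgt; apply/negP => ab.
have [m [am mb]] : exists m, a < m /\ m < b by exists ((a + b) / 2); lra.
have mgt := measurable_gtr m (Linfty_measurable X).
have mlt := measurable_ltr m (Linfty_measurable X).
have := pr_le1 P (measurableU _ _ mgt mlt); rewrite prU//; last first.
  by apply/seteqP; split=> w // [/= mX Xm]; have := lt_trans mX Xm; rewrite ltxx.
have := bP m; have := aP m; rewrite !leNgt am mb /= => /negbFE + /negbFE; lra.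
Qed.

Lemma IQD_le_central alpha X lo hi : 0 <= alpha ->
  central alpha X lo hi -> IQD alpha X <= hi - lo.
Proof.
move=> a0 [lohi Xhi Xlo]; rewrite /IQD; case: ifPn => [ah|_]; last by rewrite subr_ge0.
have h : 0 <= alpha < 1 by lra.
have [b -> bP] := QminusP X h; have [a -> aP] := QplusP X h.
by move: Xhi Xlo; rewrite bP aP /=; lra.
Qed.

Lemma IQD_central alpha X : 0 <= alpha ->
  exists lo hi, central alpha X lo hi /\ IQD alpha X = hi - lo.
Proof.
move=> a0; rewrite /IQD; case: ifPn => [ah|]; last first.
  (* At levels of at least one half, a median gives a central interval of length zero, matching the
     value 0 of [IQD]. *)
  rewrite -leNgt => ah; have [c [_ c1 c2]] := median_ex X.
  by exists c, c; rewrite subrr; split=> //; split=> //; exact: le_trans ah.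
have h : 0 <= alpha < 1 by lra.
have [b -> bP] := QminusP X h; have [a -> aP] := QplusP X h.
exists a, b; split=> //; split; rewrite ?bP ?aP// leNgt; apply/negP => ba.
(* With [b < a] the two tails would cover the space, although their probabilities add up to at most
   [2 * alpha < 1]. *)
have := pr_gtr_ltr_ge1 (Linfty_measurable X) ba.
have := bP b; have := aP a; rewrite !lexx; lra.
Qed.

Lemma IQD_ge0 alpha X : 0 <= alpha -> 0 <= IQD alpha X.
Proof. by move=> /(IQD_central X)[lo [hi [[lohi _ _] ->]]]; rewrite subr_ge0. Qed.

End quantiles.
#[global] Hint Extern 0 (measurable_fun _ _) => solve [exact: Linfty_measurable] : core.

(** * Lower bound, construction of allocations, and tail events *)

Section allocations.
Context d (T : measurableType d) (R : realType) (P : probability T R).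
Local Notation pr := (pr P).
Implicit Types (X Y : Linfty P) (f : T -> R) (A : set T).

(** The endpoints of the agents' optimal central intervals add up to a central interval of [X]:
    where [X] exceeds the sum of the upper ends, some [Y i] exceeds its own. *)
Lemma IQD_subadditive n (alpha_ : 'I_n -> R) X (Y : 'I_n -> Linfty P) :
  (forall i, 0 <= alpha_ i) ->
  allocation X Y -> IQD (\sum_(i < n) alpha_ i) X <= \sum_(i < n) IQD (alpha_ i) (Y i).
Proof.
move=> a0 XY.
have /choice[p pP] i : exists p : R * R, central P (alpha_ i) (Y i) p.1 p.2 /\
    IQD (alpha_ i) (Y i) = p.2 - p.1.
  by have [lo [hi ?]] := IQD_central (Y i) (a0 i); exists (lo, hi).
rewrite (eq_bigr _ (fun i _ => (pP i).2)) sumrB.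
apply: IQD_le_central; first exact: sumr_ge0.
have mgt i : measurable [set w | (p i).2 < Y i w] by exact: measurable_gtr.
have mlt i : measurable [set w | Y i w < (p i).1] by exact: measurable_ltr.
split.
- by apply: ler_sum => i _; have [[]] := pP i.
- apply: (@le_trans _ _ (pr (\bigcup_i [set w | (p i).2 < Y i w]))).
    apply: le_pr_ae; [exact: measurable_gtr|exact: fin_bigcup_measurable|].
    apply: filterS XY => w XYw; rewrite /= -XYw => hiY; apply: contrapT => nY; move: hiY.
    apply/negP; rewrite -leNgt; apply: ler_sum => i _; rewrite leNgt.
    by apply/negP => hiYi; apply: nY; exists i.
  apply: le_trans (pr_bigcup_ord_le _ mgt) _.
  by apply: ler_sum => i _; have [[]] := pP i.
- apply: (@le_trans _ _ (pr (\bigcup_i [set w | Y i w < (p i).1]))).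
    apply: le_pr_ae; [exact: measurable_ltr|exact: fin_bigcup_measurable|].
    apply: filterS XY => w XYw; rewrite /= -XYw => hiY; apply: contrapT => nY; move: hiY.
    apply/negP; rewrite -leNgt; apply: ler_sum => i _; rewrite leNgt.
    by apply/negP => hiYi; apply: nY; exists i.
  apply: le_trans (pr_bigcup_ord_le _ mlt) _.
  by apply: ler_sum => i _; have [[]] := pP i.
Qed.

(** The form of allocation in claim (iii): [U] is the union of the agent's own tail pieces, [V] that
    of all agents' pieces, and [k] its proportion of the rest. *)
Definition share (f : T -> R) (c : R) (U V : set T) (k e : R) (w : T) : R :=
  (f w - c) * \1_U w + k * (f w - c) * (1 - \1_V w) + e.

Lemma share_Linfty X c U V k e : measurable U -> measurable V ->
  share X c U V k e \in Lfun P +oo%E.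
Proof.
move=> mU mV; have [M XM] := Linfty_bounded X.
apply: (@bounded_Linfty _ _ _ _ _ ((1 + `|k|) * (M + `|c|) + `|e|)).
  apply: measurable_funD => //; apply: measurable_funD.
    apply: measurable_funM; first exact: measurable_funB.
    exact: measurable_indic.
  apply: measurable_funM.
    by apply: measurable_funM => //; exact: measurable_funB.
  by apply: measurable_funB => //; exact: measurable_indic.
apply: filterS XM => w XM; rewrite /share !indicE.
have Xc : `|X w - c| <= M + `|c| by rewrite (le_trans (ler_normB _ _))// lerD2r.
have kXc : `|k * (X w - c)| <= `|k| * (M + `|c|) by rewrite normrM ler_wpM2l.
apply: le_trans (ler_normD _ _) _; rewrite lerD2r.
apply: le_trans (ler_normD _ _) _; rewrite [leRHS]mulrDl mul1r; apply: lerD.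
  by case: (w \in U); rewrite ?mulr1// mulr0 normr0 (le_trans _ Xc).
by case: (w \in V); rewrite ?subr0 ?mulr1// subrr mulr0 normr0 (le_trans _ kXc).
Qed.

(** Disjointness makes the indicators of the agents' pieces add up to that of the union of [A] and
    [B]; off this union the proportions [a_] restore [f w - c], and the constants restore [c]. *)
Lemma sum_share n f c A B (A_ B_ : 'I_n -> set T) (a_ c_ : 'I_n -> R) w :
  event_partition A A_ -> event_partition B B_ -> A `&` B = set0 ->
  \sum_(i < n) a_ i = 1 -> \sum_(i < n) c_ i = c ->
  \sum_(i < n) share f c (A_ i `|` B_ i) (A `|` B) (a_ i) (c_ i) w = f w.
Proof.
move=> [_ tA UA] [_ tB UB] AB a1 cE.
rewrite big_split/= big_split/= -mulr_sumr -!mulr_suml a1 mul1r cE.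
suff -> : \sum_(i < n) \1_(A_ i `|` B_ i) w = \1_(A `|` B) w :> R.
  by rewrite mulrBr mulr1 addrC -addrA; ring.
have [] := pselect ((A `|` B) w) => ABw; last first.
  rewrite indicE memNset// big1// => i _; rewrite indicE memNset// => ABiw.
  by apply: ABw; rewrite -UA -UB; case: ABiw => ?; [left|right]; exists i.
rewrite indicE mem_set//.
have [i ABi] : exists i, (A_ i `|` B_ i) w.
  by case: ABw; rewrite -?UA -?UB => -[i _ ?]; exists i; [left|right].
rewrite (bigD1 i)//= indicE mem_set// big1 ?addr0// => j ji.
rewrite indicE memNset// => ABj; move/eqP: ji; apply.
have nAB : A w -> B w -> False by move=> Aw Bw; rewrite -[False]/(set0 w) -AB.
have inA k : A_ k w -> A w by rewrite -UA; exists k.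
have inB k : B_ k w -> B w by rewrite -UB; exists k.
case: ABi ABj => [Ai|Bi] [Aj|Bj].
- by apply: (tA j i I I); exists w.
- by case: (nAB (inA _ Ai) (inB _ Bj)).
- by case: (nAB (inA _ Aj) (inB _ Bi)).
- by apply: (tB j i I I); exists w.
Qed.

(** Since [X] is above [c] on [A] and below it on [B], the share can exceed [k * (hi - c) + e] only
    on [U] and fall below [k * (lo - c) + e] only on [V]. These two values therefore bound a central
    interval. *)
Lemma IQD_share_le (alpha : R) X Y c lo hi U V A B (k e : R) :
  0 <= alpha -> 0 <= k -> lo <= c <= hi ->
  measurable A -> measurable B -> pr U <= alpha -> pr V <= alpha ->
  measurable U -> measurable V -> U `<=` A -> V `<=` B ->
  (\forall w \ae P, A w -> c <= X w) -> (\forall w \ae P, B w -> X w <= c) ->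
  (\forall w \ae P, ~ (A `|` B) w -> lo <= X w <= hi) ->
  (\forall w \ae P, Y w = share X c (U `|` V) (A `|` B) k e w) ->
  IQD alpha Y <= k * (hi - lo).
Proof.
move=> a0 k0 /andP[loc chi] mA mB Ua Va mU mV UA VB Ac Bc ABc YE.
have -> : k * (hi - lo) = (k * (hi - c) + e) - (k * (lo - c) + e) by ring.
have khi : 0 <= k * (hi - c) by rewrite mulr_ge0// subr_ge0.
have klo : k * (lo - c) <= 0 by rewrite mulr_ge0_le0// subr_le0.
have main : \forall w \ae P,
    (~ U w -> Y w <= k * (hi - c) + e) /\ (~ V w -> k * (lo - c) + e <= Y w).
  apply: filterS3 Ac Bc (filterI ABc YE) => w {}Ac {}Bc [{}ABc ->].
  rewrite /share !indicE.
  have [ABw|nABw] := pselect ((A `|` B) w); last first.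
    rewrite (memNset nABw) memNset; last first.
      by move=> UV; apply: nABw; case: UV => [/UA|/VB]; [left|right].
    have /andP[loX Xhi] := ABc nABw.
    rewrite mulr0 add0r subr0 mulr1 !lerD2r; split=> _; rewrite ler_wpM2l// lerD2r//.
  rewrite (mem_set ABw) subrr mulr0 addr0.
  have [[Uw|Vw]|nUV] := pselect ((U `|` V) w).
  - have := Ac (UA _ Uw); rewrite mem_set ?mulr1; last by left.
    by split=> [/(_ Uw)//|_]; lra.
  - have := Bc (VB _ Vw); rewrite mem_set ?mulr1; last by right.
    by split=> [_|/(_ Vw)//]; lra.
  - by rewrite memNset// mulr0 add0r; split=> _; lra.
apply: IQD_le_central => //; split.
- lra.
- apply: le_trans Ua; apply: le_pr_ae => //; first exact: measurable_gtr.
  apply: filterS main => w [UY _] /= hiY; apply: contrapT => /UY; lra.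
- apply: le_trans Va; apply: le_pr_ae => //; first exact: measurable_ltr.
  apply: filterS main => w [_ VY] /= hiY; apply: contrapT => /VY; lra.
Qed.

Lemma allocation_ex n (alpha_ v : 'I_n -> R) X : atomless P -> (0 < n)%N ->
  (forall i, 0 <= alpha_ i) -> (forall i, 0 <= v i) -> \sum_(i < n) v i = 1 ->
  exists2 Y, allocation X Y &
    forall i, IQD (alpha_ i) (Y i) <= v i * IQD (\sum_(i < n) alpha_ i) X.
Proof.
case: n alpha_ v => // n alpha_ v P_atomless _ a0 v0 v1.
have s0 : 0 <= \sum_(i < n.+1) alpha_ i by exact: sumr_ge0.
have [lo [hi [[lohi Xhi Xlo] ->]]] := IQD_central X s0.
set A := [set w | hi < X w] in Xhi; set B := [set w | X w < lo] in Xlo.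
have mA : measurable A by exact: measurable_gtr.
have mB : measurable B by exact: measurable_ltr.
have [A_ pA A_le] := atomless_partition P_atomless mA a0 Xhi.
have [B_ pB B_le] := atomless_partition P_atomless mB a0 Xlo.
have [mA_ _ UA] := pA; have [mB_ _ UB] := pB.
(* The constants must add up to the reference point of [share], here [lo]; agent [ord0] takes it
   all. *)
pose e_ (i : 'I_n.+1) := if i == ord0 then lo else 0.
pose f i := share X lo (A_ i `|` B_ i) (A `|` B) (v i) (e_ i).
have fL i : f i \in Lfun P +oo%E by apply: share_Linfty; exact: measurableU.
pose Y i : Linfty P := Lfun_Sub (leey 1%E) (fL i).
exists Y => [|i].
  apply: nearW => w; apply: (@sum_share _ X lo A B A_ B_ v e_ w) => //.
    by apply/seteqP; split=> x // [] /= hx xl; have := lt_trans hx xl; lra.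
  by rewrite -big_mkcond big_pred1_eq.
(* The reference point [lo] meets the sign conditions: [X] exceeds [hi >= lo] on [A] and is below
   [lo] on [B]. *)
apply: (@IQD_share_le _ X _ lo lo hi (A_ i) (B_ i) A B (v i) _) => //.
- by rewrite lexx.
- by move=> w Aw; rewrite -UA; exists i.
- by move=> w Bw; rewrite -UB; exists i.
- by apply: nearW => w; rewrite /A/=; lra.
- by apply: nearW => w; rewrite /B/=; lra.
- apply: nearW => w /not_orP[] /=; rewrite /A/B/= => /negP + /negP.
  by rewrite -!leNgt => -> ->.
- exact: nearW.
Qed.

(* Both bounds read off a failure on a set of positive probability: a point of
   that set forces the inequality on almost all of the other side of [A]. *)
Lemma upper_tail_ge f A c : measurable_fun setT f -> measurable A ->
  (\forall w \ae P, \forall w' \ae P, A w -> (~` A) w' -> f w' <= f w) ->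
  pr [set w | f w < c] <= 1 - pr A -> \forall w \ae P, A w -> c <= f w.
Proof.
move=> mf mA tail fc; have mfc := measurable_ltr c mf.
have mI := measurableI _ _ mA mfc; have mC := measurableC mA.
have E : [set w | ~ (A w -> c <= f w)] = A `&` [set w | f w < c].
  apply/seteqP; split=> w /=; last by move=> [Aw fw] /(_ Aw); rewrite leNgt fw.
  by move=> /not_implyP[Aw /negP]; rewrite -ltNge.
apply: ae_pr0; rewrite E//; apply/eqP; rewrite eq_le pr_ge0 andbT leNgt.
apply/negP => I0; have [w [Aw /= fw] wP] := pr_gt0_ex mI I0 tail.
have : pr ((~` A) `|` (A `&` [set w | f w < c])) <= pr [set w | f w < c].
  apply: le_pr_ae => //; first exact: measurableU.
  by apply: filterS wP => w' fw' [/(fw' Aw)/le_lt_trans|[_]//]; apply.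
rewrite prU//; first by rewrite prC//; lra.
by rewrite setIA setICl set0I.
Qed.

Lemma upper_tail_le f A b : measurable_fun setT f -> measurable A ->
  (\forall w \ae P, \forall w' \ae P, A w -> (~` A) w' -> f w' <= f w) ->
  pr [set w | b < f w] <= pr A -> \forall w \ae P, (~` A) w -> f w <= b.
Proof.
move=> mf mA tail fb; have mfb := measurable_gtr b mf.
have mC := measurableC mA; have mI := measurableI _ _ mC mfb.
have E : [set w | ~ ((~` A) w -> f w <= b)] = ~` A `&` [set w | b < f w].
  apply/seteqP; split=> w /=; last by move=> [Aw fw] /(_ Aw); rewrite leNgt fw.
  by move=> /not_implyP[Aw /negP]; rewrite -ltNge.
apply: ae_pr0; rewrite E//; apply/eqP; rewrite eq_le pr_ge0 andbT leNgt.
apply/negP => I0.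
have : pr (A `|` (~` A `&` [set w | b < f w])) <= pr [set w | b < f w].
  apply: le_pr_ae => //; first exact: measurableU.
  (* The almost sure quantifiers are ordered, so [w'] is chosen separately for each [w]. *)
  apply: filterS tail => w wP [Aw|[]//].
  have [w' [nAw' /= bw'] fw'] := pr_gt0_ex mI I0 wP.
  exact: lt_le_trans bw' (fw' Aw nAw').
rewrite prU//; first by lra.
by rewrite setIA setICr set0I.
Qed.

End allocations.

(** * Inf-convolution and Pareto optimality *)

Section inf_convolution.
Context d (T : measurableType d) (R : realType) (P : probability T R).
Hypothesis P_atomless : atomless P.
Context (n : nat) (n_gt0 : (0 < n)%N) (alpha_ : 'I_n -> R).
Hypothesis alpha_ge0 : forall i, 0 <= alpha_ i.
Local Notation alpha := (\sum_(i < n) alpha_ i).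
Local Notation pref := (fun i : 'I_n => @IQD d T R P (alpha_ i)).
Implicit Types (X : Linfty P).

Lemma bigmin_attained (v : 'I_n -> R) :
  exists j, \big[Num.min/v (Ordinal n_gt0)]_(i < n) v i = v j.
Proof.
elim/big_ind: _ => [|x y [i ->] [j ->]|i _]; [by eexists| |by exists i].
by case: leP => _; [exists i|exists j].
Qed.

Lemma infconv_scaled_IQD (lambda_ : 'I_n -> R) X : (forall i, 0 <= lambda_ i) ->
  infconv (fun i Y => lambda_ i * IQD (alpha_ i) Y) X =
  (\big[Num.min/lambda_ (Ordinal n_gt0)]_(i < n) lambda_ i * IQD alpha X)%:E.
Proof.
move=> l0; set l := \big[_/_]_(i < n) _.
apply/eqP; rewrite eq_le; apply/andP; split.
  have [j lE] := bigmin_attained lambda_.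
  (* The proportions are concentrated on [j], so all other agents end up with cost zero. *)
  have [||Y XY Yle] := @allocation_ex _ _ _ P n alpha_ (fun i => (i == j)%:R) X
      P_atomless n_gt0 alpha_ge0; first by move=> i; exact: ler0n.
    by rewrite (bigD1 j)//= eqxx big1 ?addr0// => i /negbTE ->.
  apply: ge_ereal_inf; exists (\sum_(i < n) lambda_ i * IQD (alpha_ i) (Y i))%:E.
    by exists Y.
  rewrite lee_fin (bigD1 j)//= [l]lE big1 ?addr0 => [|i ij].
    by rewrite ler_wpM2l//; have := Yle j; rewrite eqxx mul1r.
  have := Yle i; rewrite (negbTE ij) mul0r => Yi0.
  suff -> : IQD (alpha_ i) (Y i) = 0 by rewrite mulr0.
  by apply/eqP; rewrite eq_le Yi0 IQD_ge0.
apply: le_ereal_inf_tmp => _ [Y XY <-]; rewrite lee_fin.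
have lle i : l <= lambda_ i by exact: bigmin_le_cond.
have lge : 0 <= l by rewrite /l; have [j ->] := bigmin_attained lambda_.
(* For the lower bound, each weight is lowered to the minimum [l], which leaves the unweighted
   bound. *)
apply: (@le_trans _ _ (\sum_(i < n) l * IQD (alpha_ i) (Y i))).
  by rewrite -mulr_sumr ler_wpM2l// IQD_subadditive.
by apply: ler_sum => i _; rewrite ler_wpM2r// IQD_ge0.
Qed.

Lemma infconv_IQD X : infconv pref X = (IQD alpha X)%:E.
Proof.
have := @infconv_scaled_IQD (fun=> 1) X (fun=> ler01).
have [j ->] := bigmin_attained (fun=> 1); rewrite mul1r => <-.
congr ereal_inf; apply: eq_imagel => Y _; congr EFin.
by apply: eq_bigr => i _; rewrite mul1r.
Qed.

Lemma sum_optimalP X Y :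
  sum_optimal pref X Y <->
  allocation X Y /\ \sum_(i < n) IQD (alpha_ i) (Y i) <= IQD alpha X.
Proof.
rewrite /sum_optimal infconv_IQD; split=> [[XY [->]]//|[XY le]].
by split=> //; congr EFin; apply/eqP; rewrite eq_le le IQD_subadditive.
Qed.

(* If the total [s] exceeds the optimum, the optimal allocation sharing the
   central part in proportion to the agents' current values improves on all. *)
Lemma pareto_sum_optimal X Y : pareto_optimal pref X Y <-> sum_optimal pref X Y.
Proof.
split=> [[XY Ymin]|/sum_optimalP[XY Yle]]; last first.
  (* A strict gain for one agent with no loss for the others would push the total below the
     subadditive lower bound. *)
  split=> // Z XZ ZY i; apply/eqP; rewrite eq_le ZY leNgt; apply/negP => lti.
  have := IQD_subadditive alpha_ge0 XZ; apply/negP; rewrite -ltNge.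
  apply: lt_le_trans Yle; rewrite (bigD1 i)//= [ltRHS](bigD1 i)//=.
  by apply: ltr_leD => //; apply: ler_sum.
apply/sum_optimalP; split=> //; set s := \sum_(i < n) _.
rewrite leNgt; apply/negP => lts.
have Yge0 i : 0 <= IQD (alpha_ i) (Y i) by exact: IQD_ge0.
have s0 : 0 < s by apply: le_lt_trans lts; apply: IQD_ge0; exact: sumr_ge0.
have [||Z XZ Zle] := @allocation_ex _ _ _ P n alpha_
    (fun i => IQD (alpha_ i) (Y i) / s) X P_atomless n_gt0 alpha_ge0.
- by move=> i; rewrite divr_ge0// ltW.
- by rewrite -mulr_suml mulfV// gt_eqF.
have Zlt i : IQD (alpha_ i) (Y i) / s * IQD alpha X <= IQD (alpha_ i) (Y i).
  by rewrite mulrAC -mulrA ler_piMr// ler_pdivrMr// mul1r ltW.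
have ZY := Ymin Z XZ (fun i => le_trans (Zle i) (Zlt i)).
have : s <= IQD alpha X; last by rewrite leNgt lts.
rewrite /s -(eq_bigr _ (fun i _ => ZY i)).
apply: le_trans (ler_sum _ (fun i _ => Zle i)) _.
by rewrite -!mulr_suml mulfV ?mul1r// gt_eqF.
Qed.

End inf_convolution.

(** * Tail events around a median *)

Section tails.
Context d (T : measurableType d) (R : realType) (P : probability T R).
Implicit Types (X : Linfty P).

(** Below level one half, the optimal interval contains every median: a median outside it would
    yield two events covering the space with total probability at most [alpha + 2^-1 < 1]. From one
    half on, the interval shrinks to [c]. *)
Lemma central_around_median alpha X c : 0 <= alpha -> central P 2^-1 X c c ->
  exists lo hi, [/\ central P (Num.min alpha 2^-1) X lo hi, lo <= c <= hi &
    IQD alpha X = hi - lo].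
Proof.
move=> a0 cX; have [ah|ha] := ltP alpha 2^-1; last first.
  by exists c, c; split; rewrite ?lexx// subrr /IQD ltNge ha.
have [lo [hi [[lohi Xhi Xlo] ->]]] := IQD_central X a0; have [_ Xc cX'] := cX.
exists lo, hi; split=> //; apply/andP; split; rewrite leNgt; apply/negP => lt.
  by have := pr_gtr_ltr_ge1 P (Linfty_measurable X) lt; lra.
by have := pr_gtr_ltr_ge1 P (Linfty_measurable X) lt; lra.
Qed.

Lemma right_tail_bounds beta X A c hi : right_tail_event beta X A ->
  beta <= 2^-1 -> central P 2^-1 X c c -> pr P [set w | hi < X w] <= beta ->
  (\forall w \ae P, A w -> c <= X w) /\ (\forall w \ae P, (~` A) w -> X w <= hi).
Proof.
move=> [mA PA tail] bh [_ _ Xc] Xhi; have prA : pr P A = beta by rewrite /pr PA.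
split; first by apply: upper_tail_ge => //; rewrite prA; lra.
by apply: upper_tail_le => //; rewrite prA.
Qed.

(** By reflection, [B] is an upper tail of the function [\- X]. *)
Lemma left_tail_bounds beta X B c lo : left_tail_event beta X B ->
  beta <= 2^-1 -> central P 2^-1 X c c -> pr P [set w | X w < lo] <= beta ->
  (\forall w \ae P, B w -> X w <= c) /\ (\forall w \ae P, (~` B) w -> lo <= X w).
Proof.
move=> [mB PB tail] bh [_ Xc _] Xlo; have prB : pr P B = beta by rewrite /pr PB.
have mX : measurable_fun setT (\- X) by exact: measurableT_comp.
have tailN : \forall w \ae P, \forall w' \ae P, B w -> (~` B) w' -> (\- X) w' <= (\- X) w.
  by apply: filterS tail => w; apply: filterS => w' XX Bw Bw'; rewrite lerN2 XX.
split.
  have : \forall w \ae P, B w -> - c <= (\- X) w.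
    apply: upper_tail_ge => //.
    have -> : [set w | (\- X) w < - c] = [set w | c < X w].
      by apply/seteqP; split=> w /=; rewrite ltrN2.
    by rewrite prB; lra.
  by apply: filterS => w XX /XX; rewrite lerN2.
have : \forall w \ae P, (~` B) w -> (\- X) w <= - lo.
  apply: (upper_tail_le mX mB) => //.
  have -> : [set w | - lo < (\- X) w] = [set w | X w < lo].
    by apply/seteqP; split=> w /=; rewrite ltrN2.
  by rewrite prB.
by apply: filterS => w XX /XX; rewrite lerN2.
Qed.

End tails.

(** * Assembly of the claims and optimality of the explicit allocations *)

Theorem theorem2 (d : measure_display) (T : measurableType d) (R : realType)
    (P : probability T R) (P_atomless : atomless P)
    (X : Linfty P) (n : nat) (n_gt0 : (0 < n)%N) (alpha_ : 'I_n -> R)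
    (alpha_itv : forall i, 0 <= alpha_ i < 2^-1) :
  let alpha := \sum_(i < n) alpha_ i in
  let pref := fun i : 'I_n => @IQD d T R P (alpha_ i) in
  [/\ (* (i) *)
      forall Y : 'I_n -> Linfty P,
        pareto_optimal pref X Y <-> sum_optimal pref X Y,
      (* (ii) *)
      (forall lambda_ : 'I_n -> R, (forall i, 0 <= lambda_ i) ->
         let lambda :=
           \big[Num.min/lambda_ (Ordinal n_gt0)]_(i < n) lambda_ i in
         forall Z : Linfty P,
           infconv (fun i Y => lambda_ i * IQD (alpha_ i) Y) Z
             = (lambda * IQD alpha Z)%:E) /\
      (forall Z : Linfty P, infconv pref Z = (IQD alpha Z)%:E) &
      (* (iii); the field convention [x / 0 = 0] gives [alpha_ i * beta / alpha]
         the value [0] when [alpha = 0] *)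
      let beta := Num.min alpha 2^-1 in
      forall (A B : set T) (A_ B_ : 'I_n -> set T) (a_ : 'I_n -> R)
             (c : R) (c_ : 'I_n -> R),
        right_tail_event beta X A -> left_tail_event beta X B ->
        A `&` B = set0 ->
        event_partition A A_ -> event_partition B B_ ->
        (forall i, P (A_ i) = (alpha_ i * beta / alpha)%:E /\
                   P (B_ i) = (alpha_ i * beta / alpha)%:E) ->
        (forall i, 0 <= a_ i) -> \sum_(i < n) a_ i = 1 ->
        (Qminus P 2^-1 X <= c%:E <= Qplus P 2^-1 X)%E ->
        \sum_(i < n) c_ i = c ->
        let f := fun (i : 'I_n) (w : T) =>
          (X w - c) * \1_(A_ i `|` B_ i) w
          + a_ i * (X w - c) * (1 - \1_(A `|` B) w) + c_ i in
        (forall i, f i \in Lfun P +oo%E) /\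
        (forall Y : 'I_n -> Linfty P,
           (forall i, \forall w \ae P, Y i w = f i w) ->
           pareto_optimal pref X Y)].
Proof.
move=> alpha pref.
have a0 i : 0 <= alpha_ i by case/andP: (alpha_itv i).
have alpha0 : 0 <= alpha by exact: sumr_ge0.
split.
- exact: pareto_sum_optimal.
- split=> [lambda_ l0 lambda Z|Z]; first exact: infconv_scaled_IQD.
  exact: infconv_IQD.
move=> beta A B A_ B_ a_ c c_ tA tB AB pA pB prAB a_ge0 a_sum cmed cE f.
have [mA _ _] := tA; have [mB _ _] := tB.
have [mA_ _ UA] := pA; have [mB_ _ UB] := pB.
have fE i : f i = share X c (A_ i `|` B_ i) (A `|` B) (a_ i) (c_ i) by [].
split=> [i|Y Yf]; first by rewrite fE; apply: share_Linfty; exact: measurableU.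
apply/pareto_sum_optimal => //; apply/sum_optimalP => //; split.
  have : \forall w \ae P, forall i, Y i w = f i w by exact: filter_forall.
  apply: filterS => w Yw; rewrite (eq_bigr _ (fun i _ => Yw i)).
  exact: sum_share.
move: cmed => /central_median cX.
have [lo [hi [[lohi Xhi Xlo] locchi ->]]] := central_around_median alpha0 cX.
have bh : beta <= 2^-1 by rewrite ge_min lexx orbT.
have [Ac nAhi] := right_tail_bounds tA bh cX Xhi.
have [Bc nBlo] := left_tail_bounds tB bh cX Xlo.
(* Pieces respect the agents' levels because [beta <= alpha]; for [alpha = 0] the quotient is 0. *)
have share_le i : alpha_ i * beta / alpha <= alpha_ i.
  have [->|an0] := eqVneq alpha 0; first by rewrite invr0 mulr0.
  rewrite -mulrA ler_piMr// ler_pdivrMr ?lt_neqAle 1?eq_sym ?an0//.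
  by rewrite mul1r ge_min lexx.
(* The target [hi - lo] is split in the proportions [a_ i], so that each agent's cost can be bounded
   separately. *)
rewrite -[leRHS]mul1r -a_sum mulr_suml; apply: ler_sum => i _.
have [PA PB] := prAB i.
apply: (@IQD_share_le _ _ _ P _ X (Y i) c lo hi (A_ i) (B_ i) A B _ (c_ i)) => //.
- by rewrite /pr PA share_le.
- by rewrite /pr PB share_le.
- by move=> w Aw; rewrite -UA; exists i.
- by move=> w Bw; rewrite -UB; exists i.
- apply: filterS2 nAhi nBlo => w Xw wX nAB.
  by apply/andP; split; [apply: wX|apply: Xw] => ?; apply: nAB; [right|left].
Qed.
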